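(* For each $n\ge 3$ there is a tight irreducible subcube partition of $\{0,1\}^n$ whose weight vector is $(1,n-1,n-1,0,\dots,0)$.
   Context: Subcubes of $\{0,1\}^n$ are identified with words in $\{0,1,*\}^n$. A subcube partition of length $n$ is a partition of $\{0,1\}^n$ into subcubes. It is irreducible if no subset $G$ with $1<|G|<|F|$ has a union that is a subcube; tight if every coordinate $i$ has some subcube $s$ with $s_i\ne*$. The weight of a subcube is the number of $1$s in its word. The weight vector of $F$ is $(w_0,\dots,w_n)$ where $w_h$ is the number of subcubes of $F$ of weight $h$. *)

(* Defs.v *)
From mathcomp Require Import all_boot.

Set Implicit Arguments.
Unset Strict Implicit.
Unset Printing Implicit Defensive.

(* [Some b] is the letter b in {0,1} and [None] is the letter [*]. *)
Definition word (n : nat) := {ffun 'I_n -> option bool}.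

Definition subcube (n : nat) (s : word n) : {set {ffun 'I_n -> bool}} :=
  [set x : {ffun 'I_n -> bool} |
    [forall i, (s i == None) || (s i == Some (x i))]].

(* Families of subcubes are sets of words. This loses nothing, since [subcube]
   is injective: subcubes are nonempty and determine their words. *)
Definition subcube_partition (n : nat) (F : {set word n}) : Prop :=
  partition [set subcube s | s in F] [set: {ffun 'I_n -> bool}].

Definition irreducible (n : nat) (F : {set word n}) : Prop :=
  ~ exists G : {set word n},
      [/\ G \subset F, 1 < #|G| < #|F|
        & exists t : word n, \bigcup_(s in G) subcube s = subcube t].

Definition tight (n : nat) (F : {set word n}) : Prop :=
  forall i : 'I_n, exists2 s : word n, s \in F & s i != None.

Definition weight (n : nat) (s : word n) : nat :=
  #|[set i | s i == Some true]|.

Definition weight_vector (n : nat) (F : {set word n}) : seq nat :=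
  mkseq (fun h => #|[set s in F | weight s == h]|) n.+1.

(* Main.v *)
(** Split a point of the cube into its first three bits and its tail. Over each
    tail lies a 5-cell partition of the 3-cube, consisting of [01*], [110],
    [1*1] and a partition of the remaining path [001 - 000 - 100] into an edge
    and a point: [*00] and [001] over the zero tail, [00*] and [100] over the
    others. The first three cells are taken with tail [*...*]; the nonzero
    tails are split according to the position of their first 1.

    A set of cells whose union is a subcube is closed under hulls: it contains
    every cell that meets the smallest subcube containing two of its members.
    Starting from any two cells, closing under hulls yields all of them. *)
From HB Require Import structures.
Require Import Defs.
From mathcomp Require Import all_boot.

Set Implicit Arguments.
Unset Strict Implicit.
Unset Printing Implicit Defensive.

(** * The finite type of cells *)

Inductive cell (m : nat) :=
  | cA | cB | cC | cD | cE | cL of 'I_m | cR of 'I_m.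
Arguments cA {m}.
Arguments cB {m}.
Arguments cC {m}.
Arguments cD {m}.
Arguments cE {m}.

(** This bijection with a sum of ordinals supplies the finite type structure and later turns the
    weight count into sums over ordinals. *)
Definition cell_code m (k : cell m) : 'I_5 + ('I_m + 'I_m) :=
  match k with
  | cA => inl (inord 0) | cB => inl (inord 1) | cC => inl (inord 2)
  | cD => inl (inord 3) | cE => inl (inord 4)
  | cL j => inr (inl j) | cR j => inr (inr j)
  end.

Definition cell_decode m (c : 'I_5 + ('I_m + 'I_m)) : cell m :=
  match c with
  | inl i => nth cA [:: cA; cB; cC; cD; cE] i
  | inr (inl j) => cL j | inr (inr j) => cR j
  end.

Lemma cell_codeK m : cancel (@cell_code m) (@cell_decode m).
Proof. by case=> //=; rewrite inordK. Qed.

Lemma cell_decodeK m : cancel (@cell_decode m) (@cell_code m).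
Proof.
case=> [[[|[|[|[|[|i]]]]] lti]|[j|j]] //=;
  by congr inl; apply: val_inj; rewrite /= inordK.
Qed.

HB.instance Definition _ m := Finite.copy (cell m) (can_type (@cell_codeK m)).

(** * Gluing three leading letters to a tail, for words and points alike *)

Definition build m T (a b c : T) (u : 'I_m -> T) : {ffun 'I_(3 + m) -> T} :=
  [ffun i => match split i with
             | inl i => nth a [:: a; b; c] i
             | inr j => u j
             end].

Section Build.
Variables (m : nat) (T : Type) (a b c : T) (u : 'I_m -> T).

Lemma build_head (i : 'I_3) :
  build a b c u (lshift m i) = nth a [:: a; b; c] i.
Proof. by rewrite ffunE; case: split_ordP => j /eqP; rewrite eq_shift // => /eqP->. Qed.

Lemma build_tail (j : 'I_m) : build a b c u (rshift 3 j) = u j.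
Proof. by rewrite ffunE; case: split_ordP => i /eqP; rewrite eq_shift // => /eqP->. Qed.

End Build.

Lemma forall_ord_add m (P : pred 'I_(3 + m)) :
  [forall i, P i] = [&& P (lshift m (@inord 2 0)), P (lshift m (@inord 2 1)),
                     P (lshift m (@inord 2 2)) & [forall j, P (rshift 3 j)]].
Proof.
apply/forallP/and4P => [Pall|[P0 P1 P2 /forallP Pt] i].
  by split=> //; apply/forallP.
case: (split_ordP i) => j -> //.
by case: j => -[|[|[|j]]] // ltj; [move: P0|move: P1|move: P2];
  congr (is_true (P (lshift m _))); apply: val_inj; rewrite /= inordK.
Qed.

(** * Tails sorted by the position of their first 1 *)

Definition first1 m (y : 'I_m -> bool) : option 'I_m :=
  [pick j | y j && [forall i : 'I_m, (i < j) ==> ~~ y i]].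

Definition zero_word m (i : 'I_m) : option bool := Some false.
Definition star_word m (i : 'I_m) : option bool := None.
(** The word [0...01*...*] with its 1 at [j]: its subcube consists of the tails whose first 1 is at
    [j]. *)
Definition first_word m (j i : 'I_m) : option bool :=
  if i < j then Some false else if i == j then Some true else None.

Definition fits (s : option bool) (b : bool) := (s == None) || (s == Some b).

Lemma first1_None m (y : 'I_m -> bool) :
  [forall i, fits (zero_word i) (y i)] = (first1 y == None).
Proof.
rewrite /first1; case: pickP => [j /andP[yj _]|noj].
  by apply/negbTE/forallPn; exists j; rewrite /fits yj.
rewrite eqxx; apply/forallP => i; rewrite /fits /=; case yi: (y i) => //.
case: (@arg_minnP _ i y (fun j : 'I_m => j : nat) yi) => j yj minj.
have := noj j; rewrite yj /= => /negbT/forallPn[k].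
by rewrite negb_imply negbK => /andP[ltkj /minj]; rewrite leqNgt ltkj.
Qed.

Lemma first1_Some m (y : 'I_m -> bool) (j : 'I_m) :
  [forall i, fits (first_word j i) (y i)] = (first1 y == Some j).
Proof.
have fitE i : fits (first_word j i) (y i) =
    ((i < j) ==> ~~ y i) && ((i == j) ==> y i).
  rewrite /fits /first_word; case: (ltngtP i j) => [ltij|ltji|/val_inj->].
  - by rewrite -val_eqE /= ltn_eqF //; case: (y i).
  - by rewrite -val_eqE /= gtn_eqF.
  - by rewrite eqxx; case: (y j).
have -> : [forall i, fits (first_word j i) (y i)]
    = y j && [forall i : 'I_m, (i < j) ==> ~~ y i].
  apply/forallP/andP => [fit|[yj /forallP y0] i].
    split; first by have := fit j; rewrite fitE eqxx => /andP[].
    by apply/forallP=> i; have := fit i; rewrite fitE => /andP[].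
  by rewrite fitE y0; apply/implyP => /eqP->.
rewrite /first1; case: pickP => [k /andP[yk /forallP yk0]|noj]; last first.
  by rewrite noj.
apply/andP/eqP => [[yj /forallP yj0]|[<-]]; last by split=> //; apply/forallP.
case: (ltngtP k j) => [ltkj|ltjk|/val_inj-> //].
  by have := yj0 k; rewrite ltkj yk.
by have := yk0 j; rewrite ltjk yj.
Qed.

(** * Cells as subcubes and as classes of points *)

Definition cell_word m (k : cell m) : word (3 + m) :=
  match k with
  | cA => build (Some false) (Some true) None (@star_word m)
  | cB => build (Some true) (Some true) (Some false) (@star_word m)
  | cC => build (Some true) None (Some true) (@star_word m)
  | cD => build None (Some false) (Some false) (@zero_word m)
  | cE => build (Some false) (Some false) (Some true) (@zero_word m)
  | cL j => build (Some false) (Some false) None (first_word j)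
  | cR j => build (Some true) (Some false) (Some false) (first_word j)
  end.

Definition cell_at m (a b c : bool) (o : option 'I_m) : cell m :=
  match a, b, c, o with
  | false, true, _, _ => cA
  | true, true, false, _ => cB
  | true, _, true, _ => cC
  | _, false, false, None => cD
  | false, false, true, None => cE
  | false, false, _, Some j => cL j
  | true, false, false, Some j => cR j
  end.

Definition classify m (x : {ffun 'I_(3 + m) -> bool}) : cell m :=
  cell_at (x (lshift m (@inord 2 0))) (x (lshift m (@inord 2 1)))
    (x (lshift m (@inord 2 2))) (first1 (fun j => x (rshift 3 j))).

Lemma in_subcube_build m a b c (u : 'I_m -> option bool) x :
  (x \in subcube (build a b c u : word (3 + m))) =
  [&& fits a (x (lshift m (@inord 2 0))), fits b (x (lshift m (@inord 2 1))),
      fits c (x (lshift m (@inord 2 2)))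
    & [forall j, fits (u j) (x (rshift 3 j))]].
Proof.
rewrite inE forall_ord_add !build_head !inordK //=; congr [&& _, _, _ & _].
by apply: eq_forallb => j; rewrite build_tail.
Qed.

(** The subcubes of the cells are the fibres of [classify], so they are pairwise disjoint and cover
    the cube. *)
Lemma in_cell_word m (k : cell m) x :
  (x \in subcube (cell_word k)) = (classify x == k).
Proof.
have star y : [forall j : 'I_m, fits (star_word j) (y j)] by apply/forallP.
rewrite /classify; case: k => [|||||j|j]; rewrite in_subcube_build;
rewrite ?star ?first1_None ?first1_Some;
move: (x _) (x _) (x _) (first1 _) => [] [] [] [k|];
  rewrite /fits ?(inj_eq Some_inj) /= ?andbF /=; apply/idP/eqP => //.
all: by [move/eqP-> | case=> ->].
Qed.

(** A representative with at most one 1 in its tail, so that hulls of two representatives are easy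
    to describe. *)
Definition point m a b c (o : option 'I_m) : {ffun 'I_(3 + m) -> bool} :=
  build a b c (fun j => o == Some j).

Lemma classify_point m a b c (o : option 'I_m) :
  classify (point a b c o) = cell_at a b c o.
Proof.
rewrite /classify /point !build_head !inordK //=; congr cell_at; apply/eqP.
case: o => [j|]; rewrite -?first1_Some -?first1_None; apply/forallP => i;
  rewrite build_tail //.
rewrite /fits /first_word; case: (ltngtP i j) => [ltij|ltji|/val_inj->].
- by rewrite !(inj_eq Some_inj) -val_eqE /= gtn_eqF.
- by rewrite -[i == j]val_eqE /= gtn_eqF.
- by rewrite !eqxx.
Qed.

Lemma cell_at_onto m (k : cell m) : exists a b c o, k = cell_at a b c o.
Proof.
case: k => [|||||j|j].
- by exists false, true, false, None.
- by exists true, true, false, None.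
- by exists true, true, true, None.
- by exists true, false, false, None.
- by exists false, false, true, None.
- by exists false, false, false, (Some j).
- by exists true, false, false, (Some j).
Qed.

Lemma classify_onto m (k : cell m) : exists x, classify x = k.
Proof.
have [a [b [c [o ->]]]] := cell_at_onto k.
by exists (point a b c o); rewrite classify_point.
Qed.

(** * Sets of cells closed under hulls *)

Section HullClosed.
Variables (m : nat) (K : pred (cell m)).
(** The points [z] that agree with [x] or [y] in each coordinate form the smallest subcube
    containing both. *)
Hypothesis hullK : forall x y z : {ffun 'I_(3 + m) -> bool},
  K (classify x) -> K (classify y) ->
  (forall i, z i = x i \/ z i = y i) -> K (classify z).

Lemma hull_at x1 x2 x3 o y1 y2 y3 p z1 z2 z3 q :
    K (cell_at x1 x2 x3 o) -> K (cell_at y1 y2 y3 p) ->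
    [&& (z1 == x1) || (z1 == y1), (z2 == x2) || (z2 == y2)
      & (z3 == x3) || (z3 == y3)] ->
    [|| q == o, q == p | (q == None) && (o != p)] ->
  K (cell_at z1 z2 z3 q).
Proof.
rewrite -!classify_point => Kx Ky /and3P[z1P z2P z3P] qP.
apply: (hullK Kx Ky) => i; case: (split_ordP i) => j ->.
  rewrite /point !build_head; case: j => [[|[|[|j]]] ltj] //=.
  - by case/orP: z1P => /eqP; [left|right].
  - by case/orP: z2P => /eqP; [left|right].
  - by case/orP: z3P => /eqP; [left|right].
rewrite /point !build_tail.
(* If [o != p], the two tails have no 1 in common, so the zero tail lies in their hull. *)
case/or3P: qP => [/eqP->|/eqP->|/andP[/eqP-> neq_op]]; [by left|by right|].
case: (o =P Some j) => [def_o|_]; [right|by left].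
by apply/esym/negbTE; apply: contraNneq neq_op => ->; rewrite def_o.
Qed.

(** Over any tail, the hull of [01c] in [cA] and [101] in [cC] contains every head with third bit
    [c], and [c] is arbitrary. *)
Lemma full_of_AC : K cA -> K cC -> forall k, K k.
Proof.
move=> KA KC k; have [a [b [c [o ->]]]] := cell_at_onto k.
by apply: (@hull_at false true c o true false true o) => //;
  case: a; case: b; case: c; rewrite ?eqxx.
Qed.

(** The first bit is free in [cD], so its representative is chosen opposite to the partner in that
    bit. The hull then yields [cC] or a cell already known to lead there, and [cC] with [cD] yields
    [cA]. *)
Lemma full_of_D k : K cD -> K k -> k != cD -> forall l, K l.
Proof.
have DC : K cD -> K cC -> forall l, K l.
  move=> KD KC; apply: full_of_AC => //.
  exact: (@hull_at true true true None false false false None false true true None).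
have DL j : K cD -> K (cL j) -> forall l, K l.
  move=> KD KL; apply: DC => //.
  exact: (@hull_at true false false None false false true (Some j) true false true None).
have DA : K cD -> K cA -> forall l, K l.
  move=> KD KA; apply: DC => //.
  exact: (@hull_at true false false None false true true None true false true None).
case: k => [|||||j|j] KD Kk neq_kD.
- exact: DA.
- apply: DA => //.
  exact: (@hull_at true true false None false false false None false true false None).
- exact: DC.
- by rewrite eqxx in neq_kD.
- apply: DC => //.
  exact: (@hull_at true false false None false false true None true false true None).
- exact: DL Kk.
- apply: (DL j) => //.
  by apply: (@hull_at true false false (Some j) false false false None
                      false false false (Some j)) => //=; rewrite eqxx.
Qed.

(** With no common 1 after the first bit, the hull contains a point that is zero there, and such a
    point lies in [cD] whatever its first bit. *)
Lemma D_of_hull x1 x2 x3 o y1 y2 y3 p :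
    K (cell_at x1 x2 x3 o) -> K (cell_at y1 y2 y3 p) ->
    [&& ~~ (x2 && y2), ~~ (x3 && y3) & (o == None) || (o != p)] -> K cD.
Proof.
move=> Kx Ky /and3P[x2y2 x3y3 op].
have -> : cD = cell_at x1 false false (@None 'I_m) by case: x1 {Kx}.
apply: (hull_at Kx Ky); last by rewrite /= eq_sym; case/orP: op => ->; rewrite ?orbT.
by rewrite eqxx /=; move: x2y2 x3y3; case: x2 {Kx}; case: y2 {Ky}; case: x3; case: y3.
Qed.

(** Most pairs have representatives with no common 1 after the first bit. The exceptions are [cA]
    and [cB], sharing the second bit, [cC] and [cE], sharing the third, and [cL j] and [cR j],
    sharing the 1 at [j]; their hulls first give [cC], [cA] and [cC] respectively. *)
Lemma D_of_pair k l : K k -> K l -> k != l -> K cD.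
Proof.
have AC : K cA -> K cC -> K cD by move=> KA KC; apply: full_of_AC.
have AB : K cA -> K cB -> K cD.
  move=> KA KB; apply: AC => //.
  exact: (@hull_at false true true None true true false None true true true None).
have AE : K cA -> K cE -> K cD.
  move=> Kx Ky; exact: (@D_of_hull false true false None false false true None).
have AL j : K cA -> K (cL j) -> K cD.
  move=> KA KL; exact: (@D_of_hull false true false None false false false (Some j)).
have AR j : K cA -> K (cR j) -> K cD.
  move=> KA KR; exact: (@D_of_hull false true false None true false false (Some j)).
have BC : K cB -> K cC -> K cD.
  move=> Kx Ky; exact: (@D_of_hull true true false None true false true None).
have BE : K cB -> K cE -> K cD.
  move=> Kx Ky; exact: (@D_of_hull true true false None false false true None).
have BL j : K cB -> K (cL j) -> K cD.
  move=> KB KL; exact: (@D_of_hull true true false None false false false (Some j)).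
have BR j : K cB -> K (cR j) -> K cD.
  move=> KB KR; exact: (@D_of_hull true true false None true false false (Some j)).
have CE : K cC -> K cE -> K cD.
  move=> KC KE; apply: AE => //.
  exact: (@hull_at true true true None false false true None false true true None).
have CL j : K cC -> K (cL j) -> K cD.
  move=> KC KL; exact: (@D_of_hull true false true None false false false (Some j)).
have CR j : K cC -> K (cR j) -> K cD.
  move=> KC KR; exact: (@D_of_hull true false true None true false false (Some j)).
have EL j : K cE -> K (cL j) -> K cD.
  move=> KE KL; exact: (@D_of_hull false false true None false false false (Some j)).
have ER j : K cE -> K (cR j) -> K cD.
  move=> KE KR; exact: (@D_of_hull false false true None true false false (Some j)).
have LL i j : K (cL i) -> K (cL j) -> cL i != cL j -> K cD.
  move=> KL KL' neq.
  by apply: (@D_of_hull false false false (Some i) false false false (Some j)) => //=.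
have RR i j : K (cR i) -> K (cR j) -> cR i != cR j -> K cD.
  move=> KR KR' neq.
  by apply: (@D_of_hull true false false (Some i) true false false (Some j)) => //=.
have LR i j : K (cL i) -> K (cR j) -> K cD.
  move=> KL KR; have [eq_ij|neq_ij] := eqVneq i j.
    apply: (CL i) => //; rewrite -eq_ij in KR.
    by apply: (@hull_at false false true (Some i) true false false (Some i)
                        true false true (Some i)) => //=; rewrite eqxx.
  by apply: (@D_of_hull false false false (Some i) true false false (Some j)) => //=.
case: k => [|||||i|i]; case: l => [|||||j|j] Kk Kl neq_kl;
  by [eauto | rewrite eqxx in neq_kl].
Qed.

Lemma full_of_pair k l : K k -> K l -> k != l -> forall i, K i.
Proof.
move=> Kk Kl neq_kl; have KD := D_of_pair Kk Kl neq_kl.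
have [eq_k|] := eqVneq k cD; last exact: full_of_D.
by apply: (full_of_D KD Kl); rewrite -eq_k eq_sym.
Qed.

End HullClosed.

(** * The family of all cells: partition, tightness, irreducibility *)

Lemma cell_word_inj m : injective (@cell_word m).
Proof.
move=> k l eq_kl; have [x xk] := classify_onto k.
by apply/eqP; rewrite -xk -in_cell_word -eq_kl in_cell_word xk.
Qed.

Definition cell_family m : {set word (3 + m)} := [set cell_word k | k : cell m].

Lemma cell_family_partition m : subcube_partition (cell_family m).
Proof.
apply/and3P; split.
- apply/eqP/setP => x; rewrite inE; apply/bigcupP.
  exists (subcube (cell_word (classify x))); last by rewrite in_cell_word.
  by apply/imset_f/imset_f.
- apply/trivIsetP => _ _ /imsetP[_ /imsetP[k _ ->] ->] /imsetP[_ /imsetP[l _ ->] ->].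
  move=> neq_kl; rewrite -setI_eq0; apply: contraNT neq_kl => /set0Pn[x].
  by rewrite inE !in_cell_word => /andP[/eqP-> /eqP->].
- apply/imsetP => -[_ /imsetP[k _ ->]] /setP eq0.
  by have [x /eqP] := classify_onto k; rewrite -in_cell_word -eq0 inE.
Qed.

Lemma cell_family_tight m : tight (cell_family m).
Proof.
(* The cell [cE] is a single point, so its word has no star in any coordinate. *)
move=> i; exists (cell_word cE); first exact: imset_f.
case: (split_ordP i) => j ->; last by rewrite build_tail.
by rewrite build_head; case: j => [[|[|[|j]]] ltj].
Qed.

Lemma cell_family_irreducible m : irreducible (cell_family m).
Proof.
move=> [G [/subsetP GF /andP[G_gt1 G_lt] [t Gt]]].
pose K k := cell_word k \in G.
(* As each point lies in exactly one cell, it is in the union of [G] iff its cell is selected; hull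
   closure of [K] is then inherited from the subcube of [t]. *)
have KE x : K (classify x) = (x \in subcube t).
  rewrite -Gt; apply/idP/bigcupP => [Kx|[s Gs]].
    by exists (cell_word (classify x)); rewrite ?in_cell_word.
  have /imsetP[k _ def_s] := GF s Gs.
  by rewrite def_s in_cell_word /K => /eqP->; rewrite -def_s.
have hullK (x y z : {ffun 'I_(3 + m) -> bool}) :
    K (classify x) -> K (classify y) ->
    (forall i, z i = x i \/ z i = y i) -> K (classify z).
  rewrite !KE !inE => /forallP tx /forallP ty zP; apply/forallP => i.
  by case: (zP i) => ->.
have /card_gt1P[s [s' [Gs Gs' neq_ss']]] := G_gt1.
have /imsetP[k _ def_s] := GF s Gs; have /imsetP[l _ def_s'] := GF s' Gs'.
have Kall : forall i, K i.
  apply: (full_of_pair hullK (k := k) (l := l)); rewrite /K -?def_s -?def_s' //.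
  by apply: contraNneq neq_ss' => eq_kl; rewrite def_s def_s' eq_kl.
move: G_lt; rewrite ltnNge => /negP; apply; apply: subset_leq_card.
by apply/subsetP => _ /imsetP[i _ ->]; apply: Kall.
Qed.

(** * Weights and their count *)

Lemma weight_build m a b c (u : 'I_m -> option bool) :
  weight (build a b c u : word (3 + m)) =
    (a == Some true) + (b == Some true) + (c == Some true)
    + #|[set j | u j == Some true]|.
Proof.
rewrite /weight -!sum1dep_card big_mkcond big_split_ord /= !big_ord_recl big_ord0.
rewrite !build_head /= addn0 !addnA; congr (_ + _).
rewrite [RHS]big_mkcond.
by apply: eq_bigr => j _; rewrite build_tail.
Qed.

Definition cell_weight m (k : cell m) :=
  match k with cD => 0 | cB | cC | cR _ => 2 | _ => 1 end.

Lemma weight_cell_word m (k : cell m) : weight (cell_word k) = cell_weight k.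
Proof.
have first_wt (j : 'I_m) : #|[set i | first_word j i == Some true]| = 1.
  rewrite -(cards1 j); apply: eq_card => i; rewrite !inE /first_word.
  case: (ltngtP i j) => [ltij|ltji|/val_inj->]; last by rewrite !eqxx.
    by rewrite -[i == j]val_eqE /= ltn_eqF.
  by rewrite -[i == j]val_eqE /= gtn_eqF.
have no_wt b : b != Some true -> #|[set i : 'I_m | b == Some true]| = 0.
  by move=> /negbTE nb; apply: eq_card0 => i; rewrite inE nb.
by case: k => [|||||j|j]; rewrite weight_build /= ?first_wt // no_wt.
Qed.

(** Weight 0 occurs only for [cD]; weight 1 for [cA], [cE] and the [m] cells [cL j]; weight 2 for
    [cB], [cC] and the [m] cells [cR j]. *)
Lemma card_cell_family m h :
  #|[set s in cell_family m | weight s == h]| =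
    (h == 0) + (h == 1) * (m + 2) + (h == 2) * (m + 2).
Proof.
have -> : [set s in cell_family m | weight s == h]
    = [set cell_word k | k in [pred k : cell m | cell_weight k == h]].
  apply/setP => s; rewrite inE; apply/andP/imsetP => [[/imsetP[k _ ->]]|[k kh ->]].
    by rewrite weight_cell_word; exists k.
  by rewrite weight_cell_word; split=> //; apply: imset_f.
rewrite card_imset; last exact: cell_word_inj.
rewrite -sum1_card big_mkcond (reindex (@cell_decode m)) /=; last first.
  by exists (@cell_code m) => k _; rewrite (cell_decodeK, cell_codeK).
rewrite !big_sumType /= !big_ord_recl big_ord0 /= !sum_nat_const card_ord.
by rewrite !inE /=; case: h => [|[|[|h]]] /=;
  rewrite ?(muln0, mul0n, muln1, mul1n, addn0, add0n) ?addn2.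
Qed.

Theorem theorem2p31 (n : nat) (hn : 3 <= n) :
  exists F : {set word n},
    [/\ subcube_partition F, tight F, irreducible F
      & weight_vector F = [:: 1, n - 1, n - 1 & nseq (n - 2) 0]].
Proof.
(* With [n = m + 3], both [n - 1] entries are [m + 2], and [m + 1] zeros follow. *)
case: n hn => [|[|[|m]]] // _; exists (cell_family m); split.
- exact: cell_family_partition.
- exact: cell_family_tight.
- exact: cell_family_irreducible.
apply: (@eq_from_nth _ 0) => [|h].
  by rewrite size_mkseq /= size_nseq.
rewrite size_mkseq => lth; rewrite nth_mkseq // card_cell_family.
case: h lth => [|[|[|h]]] _ //=; last by rewrite -[RHS]/(nth 0 (nseq m.+1 0) h) nth_nseq if_same.
all: by rewrite !mul0n ?mul1n ?addn0 ?add0n addn2 subn1.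
Qed.
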